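(* Let $\mathcal{C}$ and $\mathcal{D}$ be (ordered) inverse categories such that $\mathcal{D}$ is an enlargement of $\mathcal{C}$. Then the inclusion functor of their Cauchy completions $\widehat{\mathcal{C}}\hookrightarrow\widehat{\mathcal{D}}$ is an equivalence of categories.
   Context: An inverse category is a (small) category $\mathcal{C}$ in which every arrow $s:X\to Y$ has a unique arrow $s^\circ:Y\to X$ with $ss^\circ s=s$ and $s^\circ ss^\circ=s^\circ$. The composite $st$ means first $t$, then $s$. $\mathcal{C}$ also denotes its set of arrows and $\mathcal{C}^{(0)}$ its set of objects. Put $id(s)=s^\circ s$, $ir(s)=ss^\circ$. $E(\mathcal{C}(X))$ is the set of idempotent arrows $X\to X$ in $\mathcal{C}$. An ordered inverse category is an inverse category with a partial order $\leqslant$ on its arrows such that, for arrows $s,t,s',t'$ and idempotent arrows $e,f$: (I) $s\leqslant s'$, $t\leqslant t'$ imply $st\leqslant s't'$ when both composites are defined; (II) $s\leqslant t$ implies $id(s)\leqslant id(t)$ and $ir(s)\leqslant ir(t)$; (III) if $e\leqslant id(s)$ there is a unique arrow ${}_{e|}s\leqslant s$ with $id({}_{e|}s)=e$; (IV) if $f\leqslant ir(t)$ there is a unique arrow $t_{|f}\leqslant t$ with $ir(t_{|f})=f$. Let $\mathcal{C}$ be an ordered inverse subcategory of the ordered inverse category $\mathcal{D}$ (a subcategory closed under $(\ )^\circ$ which is an ordered inverse category with the induced order). $\mathcal{D}$ is an enlargement of $\mathcal{C}$ if: (I) for each $X\in\mathcal{C}^{(0)}$, $E(\mathcal{C}(X))$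 is an order ideal (down-closed subset) of $E(\mathcal{D}(X))$; (II) if $X,Y\in\mathcal{C}^{(0)}$, $e\in E(\mathcal{C}(X))$, $f\in E(\mathcal{C}(Y))$ and $s:X\to Y$ in $\mathcal{D}$ satisfies $se=s=fs$, then $s\in\mathcal{C}$; (III) for each $Y\in\mathcal{D}^{(0)}$ and $f\in E(\mathcal{D}(Y))$ there are $X\in\mathcal{C}^{(0)}$, $e\in E(\mathcal{C}(X))$ and $s:X\to Y$ in $\mathcal{D}$ with $s^\circ s=e$ and $ss^\circ=f$. The Cauchy completion $\widehat{\mathcal{C}}$ has objects the pairs $(X,e)$ with $X\in\mathcal{C}^{(0)}$ and $e:X\to X$ idempotent; arrows $(X,e)\to(Y,f)$ the triples $(e,s,f)$ with $s:X\to Y$ in $\mathcal{C}$ and $se=s=fs$; composition $(f,t,g)(e,s,f)=(e,ts,g)$. *)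

(* Defs.v *)
From Stdlib Require Import Relations Setoid ProofIrrelevance.

Set Implicit Arguments.
Unset Strict Implicit.
Unset Printing Implicit Defensive.

(** * Categories, functors, equivalences *)

Record Category := {
  Ob :> Type;
  Hom : Ob -> Ob -> Type;
  idn : forall X, Hom X X;
  comp : forall X Y Z, Hom Y Z -> Hom X Y -> Hom X Z;
  comp_assoc : forall X Y Z W (s : Hom Z W) (t : Hom Y Z) (u : Hom X Y),
    comp s (comp t u) = comp (comp s t) u;
  comp_idl : forall X Y (s : Hom X Y), comp (idn Y) s = s;
  comp_idr : forall X Y (s : Hom X Y), comp s (idn X) = s
}.

Arguments Hom {_} _ _.
Arguments idn {_} _.
Arguments comp {_ _ _ _} _ _.
Arguments comp_assoc {_ _ _ _ _} _ _ _.
Arguments comp_idl {_ _ _} _.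
Arguments comp_idr {_ _ _} _.

(** [s ∘ t] is first [t], then [s]. *)
Notation "s ∘ t" := (comp s t) (at level 40, left associativity).

Definition idempotent (C : Category) (X : C) (e : Hom X X) : Prop := e ∘ e = e.

Definition is_iso (C : Category) (X Y : C) (s : Hom X Y) : Prop :=
  exists t : Hom Y X, t ∘ s = idn X /\ s ∘ t = idn Y.

Record Functor (A B : Category) := {
  fob :> A -> B;
  fhom : forall X Y : A, Hom X Y -> Hom (fob X) (fob Y);
  fhom_id : forall X : A, fhom (idn X) = idn (fob X);
  fhom_comp : forall (X Y Z : A) (s : Hom Y Z) (t : Hom X Y),
    fhom (s ∘ t) = fhom s ∘ fhom t
}.

Arguments fhom {_ _} _ {_ _} _.

Definition functor_id (A : Category) : Functor A A :=
  {| fob := fun X : A => X;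
     fhom := fun X Y (s : Hom X Y) => s;
     fhom_id := fun _ => eq_refl;
     fhom_comp := fun _ _ _ _ _ => eq_refl |}.

Section FunctorComp.
Variables (A B C : Category) (G : Functor B C) (F : Functor A B).

Lemma functor_comp_id (X : A) : fhom G (fhom F (idn X)) = idn (G (F X)).
Proof. now rewrite !fhom_id. Qed.

Lemma functor_comp_comp (X Y Z : A) (s : Hom Y Z) (t : Hom X Y) :
  fhom G (fhom F (s ∘ t)) = fhom G (fhom F s) ∘ fhom G (fhom F t).
Proof. now rewrite !fhom_comp. Qed.

Definition functor_comp : Functor A C :=
  {| fob := fun X => G (F X);
     fhom := fun X Y (s : Hom X Y) => fhom G (fhom F s);
     fhom_id := functor_comp_id;
     fhom_comp := functor_comp_comp |}.
End FunctorComp.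

Definition naturally_isomorphic (A B : Category) (F G : Functor A B) : Prop :=
  exists alpha : forall X : A, Hom (F X) (G X),
    (forall (X Y : A) (s : Hom X Y), alpha Y ∘ fhom F s = fhom G s ∘ alpha X) /\
    (forall X : A, is_iso (alpha X)).

Definition is_equivalence (A B : Category) (F : Functor A B) : Prop :=
  exists G : Functor B A,
    naturally_isomorphic (functor_comp G F) (functor_id A) /\
    naturally_isomorphic (functor_comp F G) (functor_id B).

(** * Inverse categories *)

Record InverseCategory := {
  icat :> Category;
  inv : forall X Y : icat, Hom X Y -> Hom Y X;
  inv_l : forall (X Y : icat) (s : Hom X Y), s ∘ inv s ∘ s = s;
  inv_r : forall (X Y : icat) (s : Hom X Y), inv s ∘ s ∘ inv s = inv s;
  inv_unique : forall (X Y : icat) (s : Hom X Y) (t : Hom Y X),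
    s ∘ t ∘ s = s -> t ∘ s ∘ t = t -> t = inv s
}.

Arguments inv {_ _ _} _.

Notation "s °" := (inv s) (at level 2, left associativity, format "s °").

(** * Orders on the set of all arrows

    The order may relate arrows with different sources or targets, so it is a
    relation on the total type of arrows. *)

Record arrow (C : Category) := Arrow {
  source : C;
  target : C;
  arr : Hom source target
}.

Arguments Arrow {_ _ _} _.
Arguments arr {_} _.

Section Ordered.
Variables (C : InverseCategory).

Definition id_ (X Y : C) (s : Hom X Y) : Hom X X := s° ∘ s.
Definition ir_ (X Y : C) (s : Hom X Y) : Hom Y Y := s ∘ s°.

Record is_ordered_inverse (le : relation (arrow C)) : Prop := {
  le_order : order (arrow C) le;
  le_comp : forall (X Y Z X' Y' Z' : C)
      (s : Hom Y Z) (t : Hom X Y) (s' : Hom Y' Z') (t' : Hom X' Y'),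
    le (Arrow s) (Arrow s') -> le (Arrow t) (Arrow t') ->
    le (Arrow (s ∘ t)) (Arrow (s' ∘ t'));
  le_id_ir : forall (X Y X' Y' : C) (s : Hom X Y) (t : Hom X' Y'),
    le (Arrow s) (Arrow t) ->
    le (Arrow (id_ s)) (Arrow (id_ t)) /\ le (Arrow (ir_ s)) (Arrow (ir_ t));
  le_restriction : forall (X Y Z : C) (s : Hom X Y) (e : Hom Z Z),
    idempotent e -> le (Arrow e) (Arrow (id_ s)) ->
    exists! r : arrow C, le r (Arrow s) /\ Arrow (id_ (arr r)) = Arrow e;
  le_corestriction : forall (X Y Z : C) (t : Hom X Y) (f : Hom Z Z),
    idempotent f -> le (Arrow f) (Arrow (ir_ t)) ->
    exists! r : arrow C, le r (Arrow t) /\ Arrow (ir_ (arr r)) = Arrow f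
}.
End Ordered.

Record OrderedInverseCategory := {
  oicat :> InverseCategory;
  le : relation (arrow oicat);
  le_ordered : is_ordered_inverse le
}.

Arguments le {_} _ _.

(** * Subcategories *)

Record Subcategory (D : Category) := {
  sub_ob : D -> Prop;
  sub_hom : forall X Y : D, Hom X Y -> Prop;
  sub_source : forall (X Y : D) (s : Hom X Y), sub_hom s -> sub_ob X;
  sub_target : forall (X Y : D) (s : Hom X Y), sub_hom s -> sub_ob Y;
  sub_idn : forall X : D, sub_ob X -> sub_hom (idn X);
  sub_comp : forall (X Y Z : D) (s : Hom Y Z) (t : Hom X Y),
    sub_hom s -> sub_hom t -> sub_hom (s ∘ t)
}.

Arguments sub_hom {_} _ {_ _} _.

Lemma sig_eq (T : Type) (P : T -> Prop) (x y : {z : T | P z}) :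
  proj1_sig x = proj1_sig y -> x = y.
Proof. apply eq_sig_hprop; intros; apply proof_irrelevance. Qed.

Section SubCat.
Variables (D : Category) (C : Subcategory D).

Definition sc_ob : Type := {X : D | sub_ob C X}.
Definition sc_hom (X Y : sc_ob) : Type :=
  {s : Hom (proj1_sig X) (proj1_sig Y) | sub_hom C s}.
Definition sc_idn (X : sc_ob) : sc_hom X X :=
  exist _ (idn (proj1_sig X)) (sub_idn (proj2_sig X)).
Definition sc_comp (X Y Z : sc_ob) (s : sc_hom Y Z) (t : sc_hom X Y) : sc_hom X Z :=
  exist _ (proj1_sig s ∘ proj1_sig t) (sub_comp (proj2_sig s) (proj2_sig t)).

Lemma sc_assoc (X Y Z W : sc_ob) (s : sc_hom Z W) (t : sc_hom Y Z) (u : sc_hom X Y) :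
  sc_comp s (sc_comp t u) = sc_comp (sc_comp s t) u.
Proof. apply sig_eq; apply comp_assoc. Qed.
Lemma sc_idl (X Y : sc_ob) (s : sc_hom X Y) : sc_comp (sc_idn Y) s = s.
Proof. apply sig_eq; apply comp_idl. Qed.
Lemma sc_idr (X Y : sc_ob) (s : sc_hom X Y) : sc_comp s (sc_idn X) = s.
Proof. apply sig_eq; apply comp_idr. Qed.

Definition subcat : Category :=
  {| Ob := sc_ob; Hom := sc_hom; idn := sc_idn; comp := sc_comp;
     comp_assoc := sc_assoc; comp_idl := sc_idl; comp_idr := sc_idr |}.
End SubCat.

Record InverseSubcategory (D : InverseCategory) := {
  isub :> Subcategory D;
  sub_inv : forall (X Y : D) (s : Hom X Y), sub_hom isub s -> sub_hom isub s°
}.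

Section InverseSubCat.
Variables (D : InverseCategory) (C : InverseSubcategory D).

Definition sc_inv (X Y : subcat C) (s : Hom X Y) : Hom Y X :=
  exist _ (proj1_sig s)° (sub_inv (proj2_sig s)).

Lemma sc_inv_l (X Y : subcat C) (s : Hom X Y) : s ∘ sc_inv s ∘ s = s.
Proof. apply sig_eq; apply inv_l. Qed.
Lemma sc_inv_r (X Y : subcat C) (s : Hom X Y) : sc_inv s ∘ s ∘ sc_inv s = sc_inv s.
Proof. apply sig_eq; apply inv_r. Qed.
Lemma sc_inv_unique (X Y : subcat C) (s : Hom X Y) (t : Hom Y X) :
  s ∘ t ∘ s = s -> t ∘ s ∘ t = t -> t = sc_inv s.
Proof.
intros H1 H2; apply sig_eq; apply inv_unique.
- exact (f_equal (@proj1_sig _ _) H1).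
- exact (f_equal (@proj1_sig _ _) H2).
Qed.

Definition inverse_subcat : InverseCategory :=
  {| icat := subcat C; inv := sc_inv; inv_l := sc_inv_l; inv_r := sc_inv_r;
     inv_unique := sc_inv_unique |}.

Definition sub_arrow (a : arrow inverse_subcat) : arrow D :=
  Arrow (proj1_sig (arr a)).

Definition induced_le (R : relation (arrow D)) : relation (arrow inverse_subcat) :=
  fun a b => R (sub_arrow a) (sub_arrow b).
End InverseSubCat.

Record OrderedInverseSubcategory (D : OrderedInverseCategory) := {
  oisub :> InverseSubcategory D;
  sub_ordered : is_ordered_inverse (induced_le (C := oisub) (le (o := D)))
}.

(** * Enlargements *)

Record is_enlargement (D : OrderedInverseCategory)
    (C : OrderedInverseSubcategory D) : Prop := {
  enl_ideal : forall X : D, sub_ob C X ->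
    forall e f : Hom X X, idempotent e -> idempotent f -> sub_hom C f ->
    le (Arrow e) (Arrow f) -> sub_hom C e;
  enl_full : forall X Y : D, sub_ob C X -> sub_ob C Y ->
    forall (e : Hom X X) (f : Hom Y Y),
    idempotent e -> sub_hom C e -> idempotent f -> sub_hom C f ->
    forall s : Hom X Y, s ∘ e = s -> f ∘ s = s -> sub_hom C s;
  enl_surj : forall (Y : D) (f : Hom Y Y), idempotent f ->
    exists (X : D) (e : Hom X X) (s : Hom X Y),
      sub_ob C X /\ idempotent e /\ sub_hom C e /\ s° ∘ s = e /\ s ∘ s° = f
}.

(** * Cauchy completion *)

Section Cauchy.
Variable C : Category.

Record cauchy_ob := CauchyOb {
  cob : C;
  cidem : Hom cob cob;
  cidem_idem : idempotent cidem
}.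

(** The components [e] and [f] of a triple [(e, s, f)] are carried by the type. *)
Definition cauchy_hom (P Q : cauchy_ob) : Type :=
  {s : Hom (cob P) (cob Q) | s ∘ cidem P = s /\ cidem Q ∘ s = s}.

Definition cauchy_idn (P : cauchy_ob) : cauchy_hom P P :=
  exist _ (cidem P) (conj (cidem_idem P) (cidem_idem P)).

Lemma cauchy_comp_proof (P Q R : cauchy_ob) (t : cauchy_hom Q R) (s : cauchy_hom P Q) :
  proj1_sig t ∘ proj1_sig s ∘ cidem P = proj1_sig t ∘ proj1_sig s /\
  cidem R ∘ (proj1_sig t ∘ proj1_sig s) = proj1_sig t ∘ proj1_sig s.
Proof.
destruct t as [t [t1 t2]], s as [s [s1 s2]]; simpl; split.
- now rewrite <- comp_assoc, s1.
- now rewrite comp_assoc, t2.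
Qed.

Definition cauchy_comp (P Q R : cauchy_ob) (t : cauchy_hom Q R) (s : cauchy_hom P Q) :
  cauchy_hom P R := exist _ (proj1_sig t ∘ proj1_sig s) (cauchy_comp_proof t s).

Lemma cauchy_assoc (P Q R S : cauchy_ob)
    (s : cauchy_hom R S) (t : cauchy_hom Q R) (u : cauchy_hom P Q) :
  cauchy_comp s (cauchy_comp t u) = cauchy_comp (cauchy_comp s t) u.
Proof. apply sig_eq; apply comp_assoc. Qed.
Lemma cauchy_idl (P Q : cauchy_ob) (s : cauchy_hom P Q) :
  cauchy_comp (cauchy_idn Q) s = s.
Proof. apply sig_eq; apply (proj2_sig s). Qed.
Lemma cauchy_idr (P Q : cauchy_ob) (s : cauchy_hom P Q) :
  cauchy_comp s (cauchy_idn P) = s.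
Proof. apply sig_eq; apply (proj2_sig s). Qed.

Definition cauchy : Category :=
  {| Ob := cauchy_ob; Hom := cauchy_hom; idn := cauchy_idn; comp := cauchy_comp;
     comp_assoc := cauchy_assoc; comp_idl := cauchy_idl; comp_idr := cauchy_idr |}.
End Cauchy.

Section CauchyInclusion.
Variables (D : Category) (C : Subcategory D).

Definition cauchy_incl_ob (P : cauchy (subcat C)) : cauchy D :=
  @CauchyOb D (proj1_sig (cob P)) (proj1_sig (cidem P))
    (f_equal (@proj1_sig _ _) (cidem_idem P)).

Definition cauchy_incl_hom (P Q : cauchy (subcat C)) (s : Hom P Q) :
    Hom (cauchy_incl_ob P) (cauchy_incl_ob Q) :=
  exist _ (proj1_sig (proj1_sig s))
    (conj (f_equal (@proj1_sig _ _) (proj1 (proj2_sig s)))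
          (f_equal (@proj1_sig _ _) (proj2 (proj2_sig s)))).

Lemma cauchy_incl_id (P : cauchy (subcat C)) :
  cauchy_incl_hom (idn P) = idn (cauchy_incl_ob P).
Proof. now apply sig_eq. Qed.
Lemma cauchy_incl_comp (P Q R : cauchy (subcat C)) (s : Hom Q R) (t : Hom P Q) :
  cauchy_incl_hom (s ∘ t) = cauchy_incl_hom s ∘ cauchy_incl_hom t.
Proof. now apply sig_eq. Qed.

Definition cauchy_inclusion : Functor (cauchy (subcat C)) (cauchy D) :=
  {| fob := cauchy_incl_ob; fhom := cauchy_incl_hom;
     fhom_id := cauchy_incl_id; fhom_comp := cauchy_incl_comp |}.
End CauchyInclusion.

(** * The natural order

    Every inverse category is an ordered inverse category for its natural
    partial order, and every inverse subcategory is then an ordered inverse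
    subcategory: unordered inverse categories are the case
    [natural_ordered D], [natural_ordered_sub C]. *)

Inductive natural_le (C : InverseCategory) : relation (arrow C) :=
  NaturalLe (X Y : C) (t : Hom X Y) (e : Hom X X) :
    idempotent e -> natural_le (Arrow (t ∘ e)) (Arrow t).

Lemma comp_in (C : Category) (X Y Z W : C) (a : Hom Y Z) (b : Hom X Y) (c : Hom X Z)
    (x : Hom Z W) : a ∘ b = c -> x ∘ a ∘ b = x ∘ c.
Proof. now intros <-; rewrite comp_assoc. Qed.

Section Natural.
Variable C : InverseCategory.

Lemma inv_of_idempotent (X : C) (e : Hom X X) : idempotent e -> e° = e.
Proof. intros H; symmetry; apply inv_unique; now rewrite !H. Qed.

Lemma inv_inv (X Y : C) (s : Hom X Y) : s° ° = s.
Proof. symmetry; apply inv_unique; [apply inv_r | apply inv_l]. Qed.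

Lemma idempotent_id (X Y : C) (s : Hom X Y) : idempotent (id_ s).
Proof. unfold idempotent, id_; now rewrite comp_assoc, inv_r. Qed.

Lemma idempotent_ir (X Y : C) (s : Hom X Y) : idempotent (ir_ s).
Proof. unfold idempotent, ir_; now rewrite comp_assoc, inv_l. Qed.

Lemma idempotent_comp (X : C) (e f : Hom X X) :
  idempotent e -> idempotent f -> idempotent (e ∘ f).
Proof.
intros He Hf.
pose (x := (e ∘ f)°).
pose proof (inv_l (e ∘ f)) as H1; pose proof (inv_r (e ∘ f)) as H2.
fold x in H1, H2; rewrite !comp_assoc in H1, H2.
assert (Hx : f ∘ x ∘ e = x).
{ apply inv_unique; rewrite !comp_assoc.
  - now rewrite (comp_in _ Hf), (comp_in _ He).
  - rewrite (comp_in _ He), (comp_in _ Hf).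
    transitivity (f ∘ (x ∘ e ∘ f ∘ x) ∘ e); [now rewrite !comp_assoc | now rewrite H2]. }
assert (Hxx : idempotent x).
{ unfold idempotent.
  transitivity (f ∘ (x ∘ e ∘ f ∘ x) ∘ e); [| now rewrite H2].
  rewrite <- Hx at 1 2; now rewrite !comp_assoc. }
assert (Hef : e ∘ f = x).
{ rewrite <- (inv_of_idempotent Hxx); symmetry; apply inv_inv. }
now rewrite Hef.
Qed.

Lemma idempotent_comm (X : C) (e f : Hom X X) :
  idempotent e -> idempotent f -> e ∘ f = f ∘ e.
Proof.
intros He Hf.
pose proof (idempotent_comp He Hf) as H1; pose proof (idempotent_comp Hf He) as H2.
unfold idempotent in H1, H2; rewrite comp_assoc in H1, H2.
rewrite <- (inv_of_idempotent (idempotent_comp He Hf)).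
symmetry; apply inv_unique; rewrite !comp_assoc.
- now rewrite (comp_in _ Hf), (comp_in _ He).
- now rewrite (comp_in _ He), (comp_in _ Hf).
Qed.

(** Conjugating an idempotent past an arrow. *)
Definition pull (X Y : C) (t : Hom X Y) (e : Hom Y Y) : Hom X X := t° ∘ e ∘ t.

Lemma pull_comp (X Y : C) (t : Hom X Y) (e : Hom Y Y) :
  idempotent e -> t ∘ pull t e = e ∘ t.
Proof.
intros He; unfold pull; rewrite !comp_assoc.
rewrite (idempotent_comm (idempotent_ir t) He : t ∘ t° ∘ e = e ∘ (t ∘ t°)).
now rewrite <- comp_assoc, inv_l.
Qed.

Lemma pull_idempotent (X Y : C) (t : Hom X Y) (e : Hom Y Y) :
  idempotent e -> idempotent (pull t e).
Proof.
intros He; unfold idempotent; unfold pull at 1.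
rewrite <- comp_assoc, (pull_comp t He), comp_assoc, (comp_in _ He); reflexivity.
Qed.

Lemma inv_comp (X Y Z : C) (s : Hom Y Z) (t : Hom X Y) : (s ∘ t)° = t° ∘ s°.
Proof.
pose proof (idempotent_comm (idempotent_id s) (idempotent_ir t)) as H.
unfold id_, ir_ in H; rewrite !comp_assoc in H.
symmetry; apply inv_unique; rewrite !comp_assoc.
- transitivity (s ∘ (t ∘ t° ∘ s° ∘ s) ∘ t); [now rewrite !comp_assoc |].
  rewrite <- H, !comp_assoc, inv_l.
  now rewrite <- (comp_assoc (s ∘ t)), <- comp_assoc, (comp_assoc t), inv_l.
- transitivity (t° ∘ (s° ∘ s ∘ t ∘ t°) ∘ s°); [now rewrite !comp_assoc |].
  rewrite H, !comp_assoc, inv_r.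
  now rewrite <- (comp_assoc (t° ∘ s°)), <- comp_assoc, (comp_assoc s°), inv_r.
Qed.

Lemma id_comp_idempotent (X Y : C) (t : Hom X Y) (e : Hom X X) :
  idempotent e -> id_ (t ∘ e) = id_ t ∘ e.
Proof.
intros He; unfold id_; rewrite inv_comp, (inv_of_idempotent He), !comp_assoc.
rewrite <- (comp_assoc e).
rewrite (idempotent_comm He (idempotent_id t) : e ∘ (t° ∘ t) = t° ∘ t ∘ e).
now rewrite (comp_in _ He).
Qed.

Lemma ir_comp_idempotent (X Y : C) (t : Hom X Y) (f : Hom Y Y) :
  idempotent f -> ir_ (f ∘ t) = ir_ t ∘ f.
Proof.
intros Hf; unfold ir_; rewrite inv_comp, (inv_of_idempotent Hf), !comp_assoc.
rewrite <- (comp_assoc f).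
rewrite (idempotent_comm Hf (idempotent_ir t) : f ∘ (t ∘ t°) = t ∘ t° ∘ f).
now rewrite (comp_in _ Hf).
Qed.

Lemma natural_le_left (X Y : C) (t : Hom X Y) (f : Hom Y Y) :
  idempotent f -> natural_le (Arrow (f ∘ t)) (Arrow t).
Proof.
intros Hf; rewrite <- (pull_comp t Hf); constructor; now apply pull_idempotent.
Qed.

Lemma natural_leP (a b : arrow C) : natural_le a b ->
  exists (X Y : C) (t : Hom X Y) (e : Hom X X),
    idempotent e /\ a = Arrow (t ∘ e) /\ b = Arrow t.
Proof. now intros [X Y t e He]; exists X, Y, t, e. Qed.

Lemma Arrow_inj (X Y : C) (s t : Hom X Y) : Arrow s = Arrow t -> s = t.
Proof.
intros H; injection H as H.
apply inj_pair2 in H; now apply inj_pair2 in H.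
Qed.

Lemma natural_le_inv (X Y : C) (a : arrow C) (t : Hom X Y) :
  natural_le a (Arrow t) ->
  exists e : Hom X X, idempotent e /\ a = Arrow (t ∘ e).
Proof.
intros H; apply natural_leP in H; destruct H as (X' & Y' & t' & e & He & -> & Ht).
pose proof (f_equal (@source C) Ht) as E1; pose proof (f_equal (@target C) Ht) as E2.
simpl in E1, E2; subst X' Y'; apply Arrow_inj in Ht; subst t'; now exists e.
Qed.

Lemma natural_order : order (arrow C) (@natural_le C).
Proof.
split.
- intros [X Y t]; rewrite <- (comp_idr t) at 1; constructor; apply comp_idl.
- intros a b [X Y t] Hab Hbc.
  apply natural_le_inv in Hbc; destruct Hbc as (f & Hf & ->).
  apply natural_le_inv in Hab; destruct Hab as (e & He & ->).
  rewrite <- comp_assoc; constructor; now apply idempotent_comp.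
- intros a [X Y t] Hab Hba.
  apply natural_le_inv in Hab; destruct Hab as (e & He & ->).
  apply natural_le_inv in Hba; destruct Hba as (f & Hf & E).
  apply Arrow_inj in E; f_equal.
  transitivity (t ∘ e ∘ f ∘ e); [now rewrite <- E |].
  now rewrite <- (comp_assoc (t ∘ e)), (idempotent_comm Hf He), comp_assoc,
    (comp_in _ He), <- E.
Qed.

Lemma natural_le_right (X Y : C) (t : Hom X Y) (e : Hom X X) (r : arrow C) :
  idempotent e -> Arrow (id_ (arr r)) = Arrow e -> natural_le r (Arrow t) ->
  r = Arrow (t ∘ e).
Proof.
intros He Hr H; apply natural_le_inv in H; destruct H as (f & Hf & ->).
simpl in Hr; apply Arrow_inj in Hr; rewrite (id_comp_idempotent _ Hf) in Hr.
f_equal; rewrite <- Hr; unfold id_; now rewrite !comp_assoc, inv_l.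
Qed.

Lemma natural_le_left_inv (X Y : C) (t : Hom X Y) (f : Hom Y Y) (r : arrow C) :
  Arrow (ir_ (arr r)) = Arrow f -> natural_le r (Arrow t) -> r = Arrow (f ∘ t).
Proof.
intros Hr H; apply natural_le_inv in H; destruct H as (e & He & ->).
simpl in Hr; apply Arrow_inj in Hr; f_equal; rewrite <- Hr; unfold ir_.
rewrite inv_comp, (inv_of_idempotent He), !comp_assoc, (comp_in _ He).
rewrite <- comp_assoc, <- (comp_assoc t).
rewrite (idempotent_comm He (idempotent_id t) : e ∘ (t° ∘ t) = t° ∘ t ∘ e).
now rewrite !comp_assoc, inv_l.
Qed.

Lemma natural_is_ordered : is_ordered_inverse (@natural_le C).
Proof.
split.
- exact natural_order.
- intros X Y Z X' Y' Z' s t s' t' Hs Ht.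
  apply natural_leP in Hs; destruct Hs as (Y1 & Z1 & s1 & e & He & Es & Es').
  apply natural_le_inv in Ht; destruct Ht as (f & Hf & Et).
  pose proof (f_equal (@source C) Es) as E1; pose proof (f_equal (@target C) Es) as E2.
  pose proof (f_equal (@source C) Es') as E3; pose proof (f_equal (@target C) Es') as E4.
  pose proof (f_equal (@source C) Et) as E5.
  simpl in *; subst Y1 Z1 Y' Z' X'.
  apply Arrow_inj in Es; apply Arrow_inj in Es'; apply Arrow_inj in Et; subst s s1 t.
  rewrite <- comp_assoc, (comp_assoc e), <- (pull_comp t' He), <- comp_assoc, comp_assoc.
  constructor; apply idempotent_comp; [now apply pull_idempotent | assumption].
- intros X Y X' Y' s t H.
  apply natural_le_inv in H; destruct H as (e & He & E).
  pose proof (f_equal (@source C) E) as E1; pose proof (f_equal (@target C) E) as E2.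
  simpl in E1, E2; subst X' Y'; apply Arrow_inj in E; subst s; split.
  + rewrite (id_comp_idempotent t He); now constructor.
  + assert (E : ir_ (t ∘ e) = ir_ t ∘ pull t° e).
    { unfold ir_, pull.
      rewrite inv_comp, (inv_of_idempotent He), inv_inv, !comp_assoc.
      now rewrite (comp_in _ He), inv_l. }
    rewrite E; constructor; now apply pull_idempotent.
- intros X Y Z s e He H.
  pose proof H as H'; apply natural_le_inv in H'; destruct H' as (f & _ & E).
  pose proof (f_equal (@source C) E) as E1; simpl in E1; subst Z.
  assert (Hid : id_ (s ∘ e) = e).
  { rewrite (id_comp_idempotent s He); apply Arrow_inj in E; rewrite E.
    now rewrite comp_assoc, (idempotent_id s). }
  exists (Arrow (s ∘ e)); split; [split |].
  + now constructor.
  + simpl; now rewrite Hid.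
  + intros r [Hr Er]; symmetry; now apply natural_le_right.
- intros X Y Z t f Hf H.
  pose proof H as H'; apply natural_le_inv in H'; destruct H' as (g & _ & E).
  pose proof (f_equal (@source C) E) as E1; simpl in E1; subst Z.
  assert (Hir : ir_ (f ∘ t) = f).
  { rewrite (ir_comp_idempotent t Hf); apply Arrow_inj in E; rewrite E.
    now rewrite comp_assoc, (idempotent_ir t). }
  exists (Arrow (f ∘ t)); split; [split |].
  + now apply natural_le_left.
  + simpl; now rewrite Hir.
  + intros r [Hr Er]; symmetry; now apply natural_le_left_inv.
Qed.
End Natural.

Definition natural_ordered (D : InverseCategory) : OrderedInverseCategory :=
  {| oicat := D; le := @natural_le D; le_ordered := natural_is_ordered D |}.

Lemma induced_natural (D : InverseCategory) (C : InverseSubcategory D)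
    (a b : arrow (inverse_subcat C)) :
  induced_le (@natural_le D) a b <-> natural_le a b.
Proof.
split.
- destruct a as [X Y s], b as [X' Y' t]; unfold induced_le, sub_arrow; simpl.
  intros H; apply natural_le_inv in H; destruct H as (e & He & E).
  pose proof (f_equal (@source D) E) as E1; pose proof (f_equal (@target D) E) as E2.
  simpl in E1, E2; apply sig_eq in E1; apply sig_eq in E2; subst X' Y'.
  apply Arrow_inj in E.
  replace s with (t ∘ id_ s); [constructor; apply idempotent_id |].
  apply sig_eq; change (proj1_sig t ∘ id_ (proj1_sig s) = proj1_sig s).
  rewrite E, (id_comp_idempotent _ He); unfold id_; now rewrite !comp_assoc, inv_l.
- intros [X Y t e He]; unfold induced_le, sub_arrow; simpl.
  constructor; exact (f_equal (@proj1_sig _ _) He).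
Qed.

Lemma is_ordered_ext (C : InverseCategory) (R S : relation (arrow C)) :
  (forall a b, R a b <-> S a b) -> is_ordered_inverse R -> is_ordered_inverse S.
Proof.
intros H [[Hr Ht Ha] Hc Hi He Hf].
split.
- split.
  + intros a; apply H, Hr.
  + intros a b c; rewrite <- !H; apply Ht.
  + intros a b; rewrite <- !H; apply Ha.
- intros *; rewrite <- !H; apply Hc.
- intros *; rewrite <- !H; apply Hi.
- intros X Y Z s e Ie Le; apply H in Le; destruct (He _ _ _ _ _ Ie Le) as (r & [H1 H2] & H3).
  exists r; split; [split; [now apply H | assumption] |].
  intros r' [H4 H5]; apply H3; split; [now apply H | assumption].
- intros X Y Z s e Ie Le; apply H in Le; destruct (Hf _ _ _ _ _ Ie Le) as (r & [H1 H2] & H3).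
  exists r; split; [split; [now apply H | assumption] |].
  intros r' [H4 H5]; apply H3; split; [now apply H | assumption].
Qed.

Lemma natural_sub_is_ordered (D : InverseCategory) (C : InverseSubcategory D) :
  is_ordered_inverse (induced_le (C := C) (@natural_le D)).
Proof.
apply (@is_ordered_ext (inverse_subcat C) (@natural_le _)).
- intros a b; symmetry; apply induced_natural.
- apply natural_is_ordered.
Qed.

Definition natural_ordered_sub (D : InverseCategory) (C : InverseSubcategory D) :
    OrderedInverseSubcategory (natural_ordered D) :=
  @Build_OrderedInverseSubcategory (natural_ordered D) C (natural_sub_is_ordered C).

(* Main.v *)
Require Import Defs.
From Stdlib Require Import ClassicalEpsilon.

(** An arrow [s] of [D] between objects [(X, e)] and [(Y, f)] coming from [C]
    satisfies [s e = s = f s], which is exactly what [enl_full] asks in order to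
    place [s] in [C]; so the inclusion of Cauchy completions is full, and it is
    clearly faithful. It is essentially surjective by [enl_surj]: if
    [s° s = e] and [s s° = f], then [s] and [s°] are arrows between [(X, e)] and
    [(Y, f)], and as [e] and [f] are the identities of these objects, they are
    mutually inverse. In other words, [enl_surj] relates idempotents by arrows
    that are only partially invertible, and the Cauchy completion makes these
    arrows genuine isomorphisms.

    An equivalence comes with a quasi-inverse functor, and
    [equivalence_of_fully_faithful] builds one, with the axiom of choice, by
    transporting arrows along chosen isomorphisms. *)

Set Implicit Arguments.
Unset Strict Implicit.
Unset Printing Implicit Defensive.

Lemma dependent_choice (I : Type) (T : I -> Type) (R : forall i, T i -> Prop) :
  (forall i, exists x, R i x) -> exists f : forall i, T i, forall i, R i (f i).
Proof.
intros H.
exists (fun i => proj1_sig (constructive_indefinite_description _ (H i))).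
intros i; apply proj2_sig.
Qed.

Section FullyFaithful.
Variables (A B : Category) (F : Functor A B).

Definition faithful : Prop :=
  forall (X Y : A) (s t : Hom X Y), fhom F s = fhom F t -> s = t.

Definition full : Prop :=
  forall (X Y : A) (u : Hom (F X) (F Y)), exists s : Hom X Y, fhom F s = u.

Definition essentially_surjective : Prop :=
  forall Y : B, exists (X : A) (u : Hom (F X) Y), is_iso u.

Lemma fully_faithful_reflects_iso (X Y : A) (s : Hom X Y) :
  faithful -> full -> is_iso (fhom F s) -> is_iso s.
Proof.
intros Ffaith Ffull [t [H1 H2]].
destruct (Ffull _ _ t) as [r <-].
exists r; split; apply Ffaith; now rewrite fhom_comp, fhom_id.
Qed.

(** Choose for each [Y] an object [G Y] and an isomorphism [u Y] from
    [F (G Y)] to [Y]. Conjugating by the [u Y] and lifting along [F] makes [G]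
    a functor, the only one with these objects for which [u] is natural; the
    lift of [u (F X)] is then the other natural isomorphism. *)
Lemma equivalence_of_fully_faithful :
  faithful -> full -> essentially_surjective -> is_equivalence F.
Proof.
intros Ffaith Ffull Fsurj.
destruct (dependent_choice Fsurj) as [g Hg].
destruct (dependent_choice Hg) as [u Hu].
destruct (dependent_choice Hu) as [v Hv].
assert (vu : forall Y, v Y ∘ u Y = idn _) by apply Hv.
assert (uv : forall Y, u Y ∘ v Y = idn _) by apply Hv.
assert (exists lift : forall X Y, Hom (F X) (F Y) -> Hom X Y,
  forall X Y w, fhom F (lift X Y w) = w) as [lift Hlift].
{ apply (dependent_choice (R := fun X l => forall Y w, fhom F (l Y w) = w)); intros X.
  apply (dependent_choice (R := fun Y l => forall w, fhom F (l w) = w)); intros Y.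
  exact (dependent_choice (Ffull X Y)). }
pose (ghom := fun Y Z (s : Hom Y Z) => lift (g Y) (g Z) (v Z ∘ s ∘ u Y)).
assert (ghom_id : forall Y, ghom _ _ (idn Y) = idn (g Y)).
{ intros Y; apply Ffaith; unfold ghom.
  now rewrite Hlift, fhom_id, comp_idr. }
assert (ghom_comp : forall X Y Z (s : Hom Y Z) (t : Hom X Y),
  ghom _ _ (s ∘ t) = ghom _ _ s ∘ ghom _ _ t).
{ intros X Y Z s t; apply Ffaith; unfold ghom.
  rewrite fhom_comp, !Hlift, !comp_assoc.
  now rewrite (comp_in _ (uv Y)), comp_idr. }
assert (u_natural : forall Y Z (s : Hom Y Z), u Z ∘ fhom F (ghom _ _ s) = s ∘ u Y).
{ intros Y Z s; unfold ghom.
  now rewrite Hlift, !comp_assoc, uv, comp_idl. }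
exists {| fob := g; fhom := ghom; fhom_id := ghom_id; fhom_comp := ghom_comp |}.
split.
- exists (fun X => lift _ _ (u (F X))); split; simpl.
  + intros X Y s; apply Ffaith.
    rewrite !fhom_comp, !Hlift; apply u_natural.
  + intros X; apply fully_faithful_reflects_iso; try assumption.
    rewrite Hlift; apply Hu.
- exists u; split; [exact u_natural | exact Hu].
Qed.
End FullyFaithful.

Lemma cauchy_inclusion_faithful (D : Category) (C : Subcategory D) :
  faithful (cauchy_inclusion C).
Proof.
intros P Q s t H; apply sig_eq, sig_eq.
exact (f_equal (@proj1_sig _ _) H).
Qed.

Lemma cauchy_inclusion_full (D : OrderedInverseCategory)
    (C : OrderedInverseSubcategory D) :
  is_enlargement C -> full (cauchy_inclusion C).
Proof.
intros DC [[X HX] [e He] Ie] [[Y HY] [f Hf] If] [s [se fs]]; simpl in *.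
assert (Hs : sub_hom C s).
{ refine (enl_full DC HX HY _ He _ Hf se fs).
  - exact (f_equal (@proj1_sig _ _) Ie).
  - exact (f_equal (@proj1_sig _ _) If). }
unshelve eexists.
- exists (exist _ s Hs); split; apply sig_eq; assumption.
- now apply sig_eq.
Qed.

Lemma cauchy_inclusion_essentially_surjective (D : OrderedInverseCategory)
    (C : OrderedInverseSubcategory D) :
  is_enlargement C -> essentially_surjective (cauchy_inclusion C).
Proof.
intros DC [Y f If].
destruct (enl_surj DC If) as (X & e & s & HX & Ie & He & se & sf).
assert (Ie' : idempotent (C := subcat C) (X := exist _ X HX) (exist _ e He))
  by now apply sig_eq.
exists (CauchyOb Ie').
(* The conditions for [s] to be an arrow from [(X, e)] to [(Y, f)] become
   [s (s° s) = s] and [(s s°) s = s], and those for [s°] are dual. *)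
unshelve eexists; [exists s | unshelve eexists; [exists s° |]]; simpl.
- rewrite <- se, <- sf; split; [rewrite comp_assoc |]; apply inv_l.
- rewrite <- se, <- sf; split; [rewrite comp_assoc |]; apply inv_r.
- split; apply sig_eq; assumption.
Qed.

Theorem proposition4p24 (D : OrderedInverseCategory) (C : OrderedInverseSubcategory D) :
  is_enlargement C -> is_equivalence (cauchy_inclusion C).
Proof.
intros DC; apply equivalence_of_fully_faithful.
- apply cauchy_inclusion_faithful.
- now apply cauchy_inclusion_full.
- now apply cauchy_inclusion_essentially_surjective.
Qed.
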